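(* Let $L_A$ be a reparameterized increasing additive process with Poisson intensity measure $\tilde\nu_\alpha$ on $\mathbb{R}\times(0,+\infty)$, and let $k:\mathbb{R}\times\mathbb{R}\to\mathbb{R}^+$. Put $\bar k(x):=\lim_{t\to+\infty}k(t,x)$. Suppose that $k$ and $\tilde\nu_\alpha$ satisfy simultaneously the following conditions: (I) $t\mapsto k(t,x)$ is nondecreasing and right continuous with $\lim_{t\to-\infty}k(t,x)=0$ for every $x\in\mathbb{R}$; (II) $\int_{\mathbb{R}\times(0,+\infty)}[1-\exp\{-\lambda v\bar k(x)\}]\,\tilde\nu_\alpha(dx\,dv)<+\infty$ for every $\lambda>0$; (III) $\tilde\nu_\alpha(\mathbb{R}\times(0,+\infty))=+\infty$. Let $Z:=\{Z(t)=\int_{\mathbb{R}}k(t,x)\,dL_A(x):t\in\mathbb{R}\}$ and $\bar Z:=\lim_{t\to+\infty}Z(t)$. Then $Z$ is a random distribution function almost surely, and $F=\{F(t)=Z(t)/\bar Z:t\in\mathbb{R}\}$ is a random probability distribution function almost surely.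
   Context: All random objects are defined on a probability space $(\Omega,\mathcal{F},P)$, and ''almost surely'' refers to $P$. Here $\mathbb{R}^+$ is the set of nonnegative reals. An increasing additive process (IAP) is a nondecreasing, right-continuous process with independent increments, started at $0$. Let $\alpha$ be a nondegenerate measure on $\mathscr{B}(\mathbb{R})$ with $\alpha(\mathbb{R})=a\in(0,+\infty)$ and let $A$ be its distribution function. A reparameterized IAP $L_A=\{L_A(x):x\in\mathbb{R}\}$ is obtained from an IAP $L=\{L(y):y\ge0\}$ by the time change $y=A(x)$. It is an almost surely finite IAP uniquely determined by a family of Lévy measures $\{\nu_\alpha(x,dv):x\in\mathbb{R}\}$, its Laplace transform being $E[e^{-\lambda L_A(x)}]=\exp[-\int_0^\infty\{1-e^{-\lambda v}\}\nu_\alpha(x,dv)]$ for any $\lambda\ge0$. Its Poisson intensity measure $\tilde\nu_\alpha$ on $\mathbb{R}\times(0,+\infty)$ is defined by $\tilde\nu_\alpha((-\infty,x]\times C)=\nu_\alpha(x,C)$ for every $x\in\mathbb{R}$ and $C\in\mathscr{B}((0,+\infty))$. A random distribution function is a process whose paths are nondecreasing, right continuous, vanishing at $-\infty$ and with finite limit at $+\infty$; it is a random probability distribution function if that limit is $1$.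
   Formalization: Added: the intensity of {k̄>0}×(0,+∞) is infinite, since (I)–(III) allow k=0, where F=0/0 (if that intensity is finite, Z̄=0 with positive probability). Also k̄ is taken finite: (II) permits k̄=+∞ on a set of finite positive intensity, where Z̄=+∞ may occur. *)

(* Defs.v *)
From HB Require Import structures.
From mathcomp Require Import all_boot all_order all_algebra.
From mathcomp Require Import all_classical all_reals all_analysis.
From mathcomp Require Import measurable_realfun.

Set Implicit Arguments.
Unset Strict Implicit.
Unset Printing Implicit Defensive.

Import Order.TTheory GRing.Theory Num.Theory.
Import numFieldNormedType.Exports.

Local Open Scope classical_set_scope.
Local Open Scope ring_scope.
Local Open Scope ereal_scope.

(* Joint independence of finitely many real random variables. Since some of
   the B i may be setT, the product rule for the whole family contains the
   product rule for each of its subfamilies. *)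
Definition independent_RVs d (T : measurableType d) (R : realType)
    (P : probability T R) (n : nat) (X : 'I_n -> T -> R) : Prop :=
  forall B : 'I_n -> set R, (forall i, measurable (B i)) ->
    P (\bigcap_(i in [set: 'I_n]) (X i @^-1` B i)) =
    \prod_(i < n) P (X i @^-1` B i).

(* Increasing additive process {L y : y >= 0}; the values of the process at
   negative times are irrelevant. *)
Record iap d (T : measurableType d) (R : realType) (P : probability T R) := IAP {
  iap_process :> R -> {RV P >-> R} ;
  iap_start : forall w, iap_process 0%R w = 0%R ;
  iap_nondecreasing : forall w (y z : R), (0 <= y)%R -> (y <= z)%R ->
    (iap_process y w <= iap_process z w)%R ;
  iap_right_continuous : forall w (y : R), (0 <= y)%R ->
    iap_process z w @[z --> y^'+] --> iap_process y w ;
  iap_independent_increments : forall (n : nat) (y : nat -> R),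
    (0 <= y 0%N)%R -> (forall i, (y i <= y i.+1)%R) ->
    independent_RVs P (fun (i : 'I_n) w =>
      (iap_process (y i.+1) w - iap_process (y i) w)%R) }.

(* "Nondegenerate" in the usual sense of probability theory. *)
Definition nondegenerate_measure (R : realType) (alpha : set R -> \bar R) : Prop :=
  ~ exists x : R, alpha (~` [set x]) = 0.

Definition dist_fun (R : realType) (alpha : set R -> \bar R) (x : R) : R :=
  fine (alpha `]-oo, x]%classic).

Definition reparam d (T : measurableType d) (R : realType) (P : probability T R)
    (L : iap P) (alpha : set R -> \bar R) (x : R) (w : T) : R :=
  L (dist_fun alpha x) w.

(* w |-> (x |-> L_A(x)(w)): the arguments of reparam swapped, so that each path
   can carry the structure lebesgue_stieltjes_measure asks for. *)
Definition reparam_path d (T : measurableType d) (R : realType)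
    (P : probability T R) (L : iap P) (alpha : set R -> \bar R) (w : T) : R -> R :=
  fun x => reparam L alpha x w.

Section reparam_path_cumulative.
Context d (T : measurableType d) (R : realType) (P : probability T R).
Variables (L : iap P) (alpha : {finite_measure set R -> \bar R}).

Lemma dist_fun_ge0 x : (0 <= dist_fun alpha x)%R.
Proof. exact/fine_ge0/measure_ge0. Qed.

Lemma dist_fun_nondecreasing : {homo dist_fun alpha : x y / (x <= y)%R}.
Proof.
move=> x y xy; rewrite /dist_fun fine_le ?fin_num_measure//.
by apply: le_measure; rewrite ?inE//; exact: subset_itvl.
Qed.

Lemma dist_fun_right_continuous : right_continuous (dist_fun alpha).
Proof.
move=> a.
pose s := inf (dist_fun alpha @` `]a, (a + 1)%R]%classic).
have A_s : dist_fun alpha r @[r --> a^'+] --> s.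
  apply: (@nondecreasing_at_right_cvgr _ _ _ (BRight (a + 1)%R)).
  - by rewrite ltBSide /= ltrDl.
  - by move=> x y _ _; exact: dist_fun_nondecreasing.
  - exists 0%R => _ [x _ <-]; exact: dist_fun_ge0.
have A_ns : dist_fun alpha (a + n.+1%:R^-1)%R @[n --> \oo] --> s.
  move/cvg_at_rightP : A_s; apply; split=> [n|]; rewrite ?ltrDl //.
  rewrite -[X in _ --> X]addr0; apply: (@cvgD _ R^o); first exact: cvg_cst.
  by rewrite gtr0_cvgV0 ?cvg_shiftS; [exact: cvgr_idn | near=> n].
have A_na : dist_fun alpha (a + n.+1%:R^-1)%R @[n --> \oo] --> dist_fun alpha a.
  apply: fine_cvg; rewrite fineK ?fin_num_measure//.
  pose F n := `]-oo, (a + n.+1%:R^-1)%R]%classic.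
  suff : alpha (F n) @[n --> \oo] --> alpha (\bigcap_n F n).
    by rewrite [in X in _ --> X -> _]/F -itvNycEbigcap.
  apply: nonincreasing_cvg_mu => [| | |m n mn].
  - by rewrite -ge0_fin_numE// fin_num_measure//; exact: measurable_itv.
  - by move=> ?; exact: measurable_itv.
  - by apply: bigcap_measurable => // ? _; exact: measurable_itv.
  - apply/subsetPset; apply: subset_itvl.
    by rewrite bnd_simp lerD2l lef_pV2 ?posrE// ler_nat.
by rewrite -(cvg_unique _ A_ns A_na).
Unshelve. all: by end_near. Qed.

Lemma reparam_path_nondecreasing w : nondecreasing (reparam_path L alpha w).
Proof.
move=> x y xy; apply: iap_nondecreasing; first exact: dist_fun_ge0.
exact: dist_fun_nondecreasing.
Qed.

Lemma reparam_path_right_continuous w :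
  right_continuous (reparam_path L alpha w).
Proof.
move=> x; apply/cvgrPdist_lt => e e0.
have /cvgrPdist_lt/(_ _ e0) := @iap_right_continuous _ _ _ _ L w _ (dist_fun_ge0 x).
move=> [r /= r0 Hr].
have /cvgrPdist_lt/(_ _ r0) := @dist_fun_right_continuous x.
apply: filterS2; last exact: (nbhs_right_gt x).
move=> z xz Hz; rewrite /reparam_path /reparam.
have := dist_fun_nondecreasing (ltW xz).
rewrite le_eqVlt => /orP[/eqP <-|lt]; first by rewrite subrr normr0.
exact: Hr.
Qed.

HB.instance Definition _ w := isCumulative.Build R _ R (reparam_path L alpha w)
  (reparam_path_nondecreasing w) (@reparam_path_right_continuous w).

End reparam_path_cumulative.

(* The random variable w |-> \int_R g(x) dL_A(x)(w), a pathwise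
   Lebesgue-Stieltjes integral. *)
Definition reparam_integral d (T : measurableType d) (R : realType)
    (P : probability T R) (L : iap P)
    (alpha : {finite_measure set R -> \bar R}) (g : R -> R) (w : T) : \bar R :=
  \int[lebesgue_stieltjes_measure (reparam_path L alpha w)]_x (g x)%:E.

(* Measures on (0, +oo) and R * (0, +oo) are represented by measures on R and
   R * R of which only the traces on `]0, +oo[ and setT `*` `]0, +oo[ matter. *)

Definition is_levy_measure (R : realType) (nu : {measure set R -> \bar R}) : Prop :=
  \int[nu]_(v in `]0%R, +oo[) (Num.min v 1)%:E < +oo.

Definition has_levy_family d (T : measurableType d) (R : realType)
    (P : probability T R) (X : R -> T -> R)
    (nu : R -> {measure set R -> \bar R}) : Prop :=
  forall x, is_levy_measure (nu x) /\
    forall lambda : R, (0 <= lambda)%R ->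
      'E_P[fun w => expR (- (lambda * X x w))] =
      expeR (- \int[nu x]_(v in `]0%R, +oo[) (1 - expR (- (lambda * v)))%:E).

Definition is_poisson_intensity (R : realType)
    (nu : R -> {measure set R -> \bar R})
    (nut : {measure set (R * R) -> \bar R}) : Prop :=
  forall (x : R) (C : set R), measurable C -> C `<=` `]0%R, +oo[ ->
    nut (`]-oo, x]%classic `*` C) = nu x C.

Definition df_path (R : realType) (l : R) (f : R -> \bar R) : Prop :=
  [/\ {homo f : s t / (s <= t)%R >-> s <= t}, right_continuous f,
      f t @[t --> -oo%R] --> 0 & f t @[t --> +oo%R] --> l%:E].

(* Processes with values in \bar R; finiteness of almost every path is part of
   df_path, since the limit at +oo is finite. *)
Definition as_random_df d (T : measurableType d) (R : realType)
    (P : probability T R) (Z : R -> T -> \bar R) : Prop :=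
  (forall t, measurable_fun setT (Z t)) /\
  {ae P, forall w, exists l : R, df_path l (Z ^~ w)}.

Definition as_random_pdf d (T : measurableType d) (R : realType)
    (P : probability T R) (F : R -> T -> \bar R) : Prop :=
  (forall t, measurable_fun setT (F t)) /\
  {ae P, forall w, df_path 1%R (F ^~ w)}.

(* Main.v *)
Require Import Defs.
From mathcomp Require Import all_boot all_order all_algebra.
From mathcomp Require Import all_classical all_reals all_analysis.
From mathcomp Require Import measurable_realfun.
From mathcomp Require Import lra.
Import Order.TTheory GRing.Theory Num.Theory.
Import numFieldNormedType.Exports.
Local Open Scope classical_set_scope.
Local Open Scope ring_scope.
Local Open Scope ereal_scope.

(** Write [I f w] for [reparam_integral L alpha f w], the integral of [f]
    against the Stieltjes measure of the path of [L_A] at [w], and [J f] for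
    [levy_exponent nut f], the integral of [1 - exp (- (v * f x))] against the
    intensity measure. Everything rests on the Laplace functional
    [E (exp (- I f)) = exp (- J f)], valid for every nonnegative Borel [f]
    ([laplace_functional]).

    Given this formula, the theorem is a matter of scaling. By monotone
    convergence the limit of [Z] at [+oo] is [I kbar]. Replacing [kbar] by
    [c * kbar] and letting [c] go to [0], dominated convergence, licensed by
    condition (II), gives [J (c * kbar) --> 0], so that [I kbar] is almost
    surely finite ([ae_reparam_integral_lty]). Letting [c] go to [+oo] instead,
    [J (c * kbar)] increases to the intensity of [{kbar > 0} * (0, +oo)], which
    is infinite, so that [I kbar] is almost surely positive
    ([ae_reparam_integral_gt0]). On the event [0 < I kbar < +oo] the function
    [kbar] dominates all the [k t], and dominated convergence carries
    right-continuity and the limit at [-oo] from [t |-> k t x] to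
    [t |-> Z t w]; dividing by the positive finite limit gives [F].

    The Laplace functional is first computed for step functions
    ([laplace_step]): the increments of [L_A] over the cells are independent,
    and the Laplace transform of one increment is the quotient of the
    transforms at its two endpoints, which the Levy family provides. Both sides
    are stable under dominated and monotone limits, but neither is linear in
    [f], so the usual monotone class theorem for vector spaces of functions
    does not apply; [step_function_induction] is the substitute, which reaches
    all nonnegative Borel functions through such limits only. *)

Set Implicit Arguments.
Unset Strict Implicit.
Unset Printing Implicit Defensive.

(** * Step functions on the line *)

Section step_functions.
Context {R : realType}.
Implicit Types (s : seq R) (h : R -> R).

(** Instead of listing intervals and values, a step function is described by
    the points [s] where it may jump: two arguments that no point of [s]
    separates have the same value, and the value is [0] to the left and to the
    right of all of [s]. Common refinements are then concatenations of lists. *)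
Definition step_on s h :=
  (forall x y, (forall p, p \in s -> (p < x)%R = (p < y)%R) -> h x = h y) /\
  (forall b x, (forall p, p \in s -> (p < x)%R = b) -> h x = 0%R).

(** The points of [s] in increasing order, continued by the largest one, so
    that the sequence is nondecreasing at all indices. *)
Definition grid s (i : nat) : R :=
  nth (last 0%R (sort <=%R s)) (sort <=%R s) i.

Lemma step_on_op s1 s2 h1 h2 (op : R -> R -> R) : op 0%R 0%R = 0%R ->
  step_on s1 h1 -> step_on s2 h2 ->
  step_on (s1 ++ s2) (fun x => op (h1 x) (h2 x)).
Proof.
move=> op0 [h1c h10] [h2c h20]; split.
  move=> x y xy; congr op.
    by apply: h1c => p ps; apply: xy; rewrite mem_cat ps.
  by apply: h2c => p ps; apply: xy; rewrite mem_cat ps orbT.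
move=> b x xb; rewrite (h10 b) ?(h20 b)// => p ps; apply: xb;
  by rewrite mem_cat ps ?orbT.
Qed.

Lemma step_on_comp s h (phi : R -> R) : phi 0%R = 0%R ->
  step_on s h -> step_on s (phi \o h).
Proof.
move=> phi0 [hc h0]; split=> [x y xy|b x xb] /=; first by rewrite (hc x y xy).
by rewrite (h0 b).
Qed.

Lemma step_on_itv (a b : R) : step_on [:: a; b] \1_(`]a, b]%classic).
Proof.
split=> [x y xy|c x xc].
  have := xy a; have := xy b; rewrite !inE !eqxx !orbT => /(_ isT) yb /(_ isT) ya.
  rewrite !indicE !mem_setE !in_itv/= ya.
  by rewrite (leNgt x) (leNgt y) yb.
have := xc a; have := xc b; rewrite !inE !eqxx !orbT => /(_ isT) yb /(_ isT) ya.
rewrite indicE mem_setE in_itv/= ya leNgt yb.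
by case: (c).
Qed.

Lemma grid_nondecreasing s i : (grid s i <= grid s i.+1)%R.
Proof.
rewrite /grid; set t := sort _ _.
have st : sorted <=%R t by rewrite sort_sorted//; exact: le_total.
have [it|ti] := ltnP i.+1 (size t).
  by apply: (sorted_leq_nth le_trans lexx) => //; rewrite inE// ltnW.
rewrite [X in (_ <= X)%R]nth_default//.
have [it|{}ti] := ltnP i (size t); last by rewrite nth_default.
have t0 : (0 < size t)%N by exact: leq_trans it.
have -> : i = (size t).-1.
  by apply/eqP; rewrite eqn_leq -ltnS prednK// it -ltnS prednK.
by rewrite nth_last; case: (t).
Qed.

(** The cell of [y] is found by counting: if [c] points of [s] are below [y],
    then only the interval that ends at the point of index [c] contains [y];
    for [c = 0] and [c = size s] no interval does, and [h y] is [0]. *)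
Lemma step_onE s h : step_on s h -> forall y,
  h y = (\sum_(i < (size s).-1)
    h (grid s i.+1) * \1_(`]grid s i, grid s i.+1]%classic) y)%R.
Proof.
move=> [hc h0] y; rewrite /grid; set t := sort _ _; set x0 := last _ _.
have st : sorted <=%R t by rewrite sort_sorted//; exact: le_total.
have ts : size t = size s by rewrite size_sort.
have mem_t p : (p \in s) = (p \in t) by rewrite mem_sort.
pose c := count (< y)%R t.
have ltc i : (i < size t)%N -> (nth x0 t i < y)%R = (i < c)%N.
  move=> it; have [ic|ci] := ltnP i c; first exact: nth_count_lt.
  by apply/negbTE; rewrite -leNgt; apply: nth_count_ge => //; rewrite ci.
have indE (i : 'I_(size s).-1) :
    \1_(`]nth x0 t i, nth x0 t i.+1]%classic) y = (i.+1 == c)%:R :> R.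
  have it : (i.+1 < size t)%N.
    by rewrite ts -ltn_predRL.
  rewrite indicE mem_setE in_itv/= leNgt !ltc// ?(ltnW it)// -leqNgt.
  by rewrite andbC -eqn_leq eq_sym.
under eq_bigr do rewrite indE.
have [c0|c0] := posnP c.
  rewrite big1 => [|i _]; last by rewrite c0 mulr0.
  apply: (h0 false) => p; rewrite mem_t => /(nthP x0)[j jt <-].
  by rewrite ltc// c0.
have [ct|ct] := ltnP c (size t); last first.
  rewrite big1 => [|i _]; last first.
    by rewrite ltn_eqF ?mulr0// (leq_trans _ ct)// ts -ltn_predRL.
  apply: (h0 true) => p; rewrite mem_t => /(nthP x0)[j jt <-].
  by rewrite ltc// (leq_trans jt).
have c1 : (c.-1 < (size s).-1)%N.
  by rewrite -ts -ltnS !prednK// (leq_trans _ ct).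
rewrite (bigD1 (Ordinal c1))//= prednK// eqxx mulr1 big1 ?addr0 => [|i].
  apply: hc => p; rewrite mem_t => /(nthP x0)[j jt <-].
  have yc : (y <= nth x0 t c)%R by rewrite leNgt ltc// ltnn.
  rewrite ltc//; have [jc|cj] := ltnP j c.
    by apply/esym/(lt_le_trans _ yc); rewrite ltc.
  apply/esym/negbTE; rewrite -leNgt.
  by apply: (sorted_leq_nth le_trans lexx) => //; rewrite inE.
rewrite -val_eqE/= => ic; case: eqP => [ic'|]; last by rewrite mulr0.
by rewrite -ic'/= eqxx in ic.
Qed.

Lemma measurable_step_on s h : step_on s h -> measurable_fun setT h.
Proof.
move=> sh; apply: (eq_measurable_fun (fun y => (\sum_(i < (size s).-1)
    h (grid s i.+1) * \1_(`]grid s i, grid s i.+1]%classic) y)%R)).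
  by move=> y _; rewrite -step_onE.
apply: measurable_sum => i.
apply: measurable_funM; first exact: measurable_cst.
by apply: measurable_indic; exact: measurable_itv.
Qed.

End step_functions.

(** * From step functions to Borel functions *)

Section step_function_induction.
Context {R : realType}.

(** This ring consists of the finite unions of bounded half-open intervals. *)
Definition step_ring : set (set R) := [set A | exists s, step_on s (\1_A : R -> R)].

Lemma setring_step_ring : setring step_ring.
Proof.
split.
- by exists [::]; split=> *; rewrite !indic0.
- move=> A B [s sA] [t tB]; exists (s ++ t).
  rewrite (_ : \1_(A `|` B) = fun x => Num.max (\1_A x) (\1_B x) : R).
    by apply: (step_on_op (op := Num.max)) => //; rewrite maxxx.
  apply/funext => x; rewrite !indicE in_setU.
  by case: (x \in A); case: (x \in B); rewrite ?maxxx// ?(max_r ler01) ?(max_l ler01).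
- move=> A B [s sA] [t tB]; exists (s ++ t).
  rewrite (_ : \1_(A `\` B) = fun x => \1_A x * (1 - \1_B x) : R)%R.
    by apply: (step_on_op (op := fun a b => a * (1 - b))%R) => //; rewrite mul0r.
  apply/funext => x; rewrite !indicE in_setD.
  by case: (x \in A); case: (x \in B); rewrite ?subrr ?subr0 ?mulr0 ?mulr1.
Qed.

Lemma measurable_step_ring A : step_ring A -> measurable A.
Proof.
move=> [s /measurable_step_on mA].
rewrite (_ : A = setT `&` (\1_A : R -> R) @^-1` [set 1%R]); first exact: mA.
rewrite setTI; apply/seteqP; split=> x /=; rewrite indicE; first by move=> /mem_set ->.
by case: (boolP (x \in A)) => [/set_mem//|_ /eqP]; rewrite eq_sym oner_eq0.
Qed.

Lemma sub_g_sigma_ring_step_ring (A : set R) : measurable A -> <<sr step_ring>> A.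
Proof.
have itvS a b : <<sr step_ring>> (`]a, b]%classic : set R).
  by apply: sub_g_sigma_ring; exists [:: a; b]; exact: step_on_itv.
have [S0 SD SU] := smallest_sigma_ring step_ring.
have ST : <<sr step_ring>> (setT : set R).
  rewrite (_ : setT = \bigcup_n `](- n%:R)%R, n%:R]%classic); first exact: SU.
  by rewrite bigcup_itvT.
move: A; apply: smallest_sub; first by split=> // B SB; exact: SD.
by move=> _ [[a b] _ <-].
Qed.

Lemma cvg_indic_bigcup (F : (set R)^nat) (x : R) : nondecreasing_seq F ->
  \1_(F n) x @[n --> \oo] --> (\1_(\bigcup_n F n) x : R).
Proof.
move=> ndF; have [[N _ FNx]|nFx] := pselect ((\bigcup_n F n) x); last first.
  rewrite (_ : (fun n => _) = cst (\1_(\bigcup_n F n) x : R)); first exact: cvg_cst.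
  apply/funext => n /=; rewrite !indicE !memNset// => Fx; apply: nFx.
  by exists n.
apply: cvg_near_cst; exists N => // n /= Nn.
rewrite !indicE !mem_set//; first by exists N.
by have /subsetPset := ndF _ _ Nn; exact.
Qed.

Lemma cvg_indic_bigcap (F : (set R)^nat) (x : R) : nonincreasing_seq F ->
  \1_(F n) x @[n --> \oo] --> (\1_(\bigcap_n F n) x : R).
Proof.
move=> niF.
have indC (A : set R) : \1_A x = (1 - \1_(~` A) x)%R :> R.
  by rewrite !indicE in_setC; case: (x \in A); rewrite ?subr0 ?subrr.
rewrite indC setC_bigcap; under eq_cvg do rewrite indC.
apply: (@cvgB _ R^o); first exact: cvg_cst.
by apply: cvg_indic_bigcup => m n mn; apply/subsetPset/subsetC/subsetPset/niF.
Qed.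

Variable Q : (R -> R) -> Prop.
Hypothesis Qstep : forall s h, step_on s h -> (forall x, 0 <= h x)%R -> Q h.
Hypothesis Qdominated : forall (f_ : nat -> R -> R) f s g,
  (forall n, measurable_fun setT (f_ n)) -> step_on s g ->
  (forall n x, 0 <= f_ n x <= g x)%R ->
  (forall x, f_ n x @[n --> \oo] --> f x) -> (forall n, Q (f_ n)) -> Q f.
Hypothesis Qmonotone : forall (f_ : nat -> R -> R) f,
  (forall n, measurable_fun setT (f_ n)) -> (forall n x, 0 <= f_ n x)%R ->
  (forall x, nondecreasing_seq (f_ ^~ x)) ->
  (forall x, f_ n x @[n --> \oo] --> f x) -> (forall n, Q (f_ n)) -> Q f.

(** The sets [B r] are freed one at a time. The induction on [l] keeps an
    arbitrary step function [h] aside, and for a fixed tail the sets that may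
    be put in the head position form a monotone class; it contains the ring of
    step sets, because [h] absorbs the indicator of such a set. The window
    [(- m, m]] provides a step function that dominates all terms. *)
Lemma step_function_induction_simple (m : R) (l : seq R) (B : R -> set R) s h :
  (forall r, measurable (B r)) -> step_on s h -> (forall x, 0 <= h x)%R ->
  Q (fun x => (h x + \sum_(r <- l) `|r| * \1_(B r `&` `](- m)%R, m]%classic) x)%R).
Proof.
move=> mB; elim: l s h => [|r l IH] s h sh h0.
  under eq_fun do rewrite big_nil addr0; exact: (Qstep sh).
set W := `](- m)%R, m]%classic.
pose T C h x := (h x + `|r| * \1_(C `&` W) x +
  \sum_(r <- l) `|r| * \1_(B r `&` W) x)%R.
pose G := [set C | measurable C /\
  forall s h, step_on s h -> (forall x, 0 <= h x)%R -> Q (T C h)].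
suff GB : G (B r).
  have -> : (fun x => h x + \sum_(r <- r :: l) `|r| * \1_(B r `&` W) x)%R = T (B r) h.
    by apply/funext => x; rewrite big_cons addrA.
  exact: GB.2 sh h0.
have stepW : step_on [:: (- m)%R; m] (\1_W : R -> R) by exact: step_on_itv.
have mW : measurable W by exact: measurable_itv.
have lim F C : (forall n, G (F n)) -> measurable C ->
    (forall x, \1_(F n) x @[n --> \oo] --> (\1_C x : R)) -> G C.
  move=> GF mC FC; split=> // s' h' sh' h'0.
  have msum : measurable_fun setT
      (fun x => \sum_(r <- l) `|r| * \1_(B r `&` W) x : R)%R.
    apply: measurable_sum => i; apply: measurable_funM; first exact: measurable_cst.
    by apply: measurable_indic; exact: measurableI.
  (* [h' + K * \1_W] is a step function above all the approximations. *)
  pose K := (`|r| + \sum_(r <- l) `|r|)%R.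
  apply: (@Qdominated (fun n => T (F n) h') _ (s' ++ [:: (- m)%R; m])
    (fun x => h' x + K * \1_W x)%R).
  - move=> n; apply: measurable_funD => //; apply: measurable_funD.
      exact: measurable_step_on sh'.
    apply: measurable_funM; first exact: measurable_cst.
    by apply: measurable_indic; apply: measurableI => //; exact: (GF n).1.
  - by apply: (step_on_op (op := fun a b => a + K * b)%R) => //; rewrite mulr0 addr0.
  - move=> n x; rewrite /T -addrA; apply/andP; split.
      rewrite !addr_ge0 ?mulr_ge0// sumr_ge0// => i _; rewrite mulr_ge0//.
    rewrite lerD2l /K mulrDl lerD//.
      by rewrite ler_wpM2l// !indicE in_setI; case: (_ \in F n); rewrite ?mul1r// mul0r.
    rewrite mulr_suml ler_sum// => i _.
    by rewrite ler_wpM2l// !indicE in_setI; case: (_ \in B i); rewrite ?mul1r// mul0r.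
  - move=> x; apply: (@cvgD _ R^o); last exact: cvg_cst.
    apply: (@cvgD _ R^o); first exact: cvg_cst.
    apply: (@cvgM R); first exact: cvg_cst.
    rewrite !indicI/=; under eq_cvg do rewrite indicI/=.
    by apply: (@cvgM R); [exact: FC|exact: cvg_cst].
  - by move=> n; exact: (GF n).2 sh' h'0.
apply: (monotone_setring_sub_g_sigma_ring _ setring_step_ring);
    last exact: sub_g_sigma_ring_step_ring.
  split=> F ndF GF; apply: (lim _ _ GF).
  - by apply: bigcup_measurable => n _; exact: (GF n).1.
  - by move=> x; exact: cvg_indic_bigcup.
  - by apply: bigcap_measurable => // n _; exact: (GF n).1.
  - by move=> x; exact: cvg_indic_bigcap.
move=> C SC; have [t tC] := SC; split; first exact: measurable_step_ring.
move=> s' h' sh' h'0; apply: (IH ((s' ++ t) ++ [:: (- m)%R; m])).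
  under eq_fun do rewrite indicI/=.
  rewrite (_ : (fun x => _) = (fun x => h' x + `|r| * (\1_C x * \1_W x)))%R//.
  have := @step_on_op R _ _ _ _ (fun a b => `|r| * (a * b))%R _ tC stepW.
  rewrite !mulr0 => /(_ erefl) CW; rewrite -catA.
  by apply: (step_on_op (op := fun a b => a + b)%R) sh' CW; rewrite addr0.
by move=> x; rewrite addr_ge0// mulr_ge0.
Qed.

Import HBNNSimple.

(** A nonnegative Borel function is the increasing limit of simple functions
    cut off to the windows [(- n, n]]. *)
Lemma step_function_induction (f : R -> R) :
  measurable_fun setT f -> (forall x, 0 <= f x)%R -> Q f.
Proof.
move=> mf f0; have mEf : measurable_fun setT (EFin \o f) by exact/measurable_EFinP.
pose g := nnsfun_approx measurableT mEf.
pose W n : set R := `](- n%:R)%R, n%:R]%classic.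
have mW n : measurable (W n) by exact: measurable_itv.
have ndW : nondecreasing_seq W.
  move=> m n mn; apply/subsetPset => x; rewrite /W/= !in_itv/= => /andP[mx xm].
  by rewrite (le_lt_trans _ mx) ?lerN2 ?ler_nat// (le_trans xm) ?ler_nat.
have UW : \bigcup_n W n = setT by exact: bigcup_itvT.
apply: (@Qmonotone (fun n x => g n x * \1_(W n) x)%R).
- by move=> n; apply: measurable_funM => //; exact: measurable_indic.
- by move=> n x; rewrite mulr_ge0.
- move=> x m n mn; rewrite ler_pM//; first exact/lefP/nd_nnsfun_approx.
  rewrite !indicE; have [xW|] := boolP (x \in W m); last by [].
  by rewrite mem_set//; move/set_mem : xW; apply/subsetPset/ndW.
- move=> x; rewrite -[f x]mulr1; apply: (@cvgM R).
    have /fine_cvgP[_] := @cvg_nnsfun_approx _ _ _ _ measurableT _ mEf (fun x _ => f0 x) x I.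
    exact.
  by have := @cvg_indic_bigcup W x ndW; rewrite UW indicT.
- move=> n.
  rewrite (_ : (fun x => _) = (fun x => cst 0 x +
      \sum_(r <- finmap.enum_fset (fset_set (range (g n))))
        `|r| * \1_(g n @^-1` [set r] `&` `](- n%:R)%R, n%:R]%classic) x)%R).
    apply: (@step_function_induction_simple n%:R _ _ [::]) => //.
  apply/funext => x; rewrite add0r [in LHS](fimfunE (g n) x).
  rewrite fsbig_finite//= mulr_suml; apply: eq_bigr => r _.
  rewrite indicI/= mulrA; congr (_ * _)%R.
  rewrite !indicE; have [/set_mem/= <-|_] := boolP (x \in _); last by rewrite !mulr0.
  by rewrite ger0_norm.
Qed.

End step_function_induction.

(** * Convergence theorems for nonnegative functions *)

Section convergence.
Context d (T : measurableType d) (R : realType).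
Variables (mu : {measure set T -> \bar R}) (D : set T) (mD : measurable D).

Lemma ge0_cvg_dominated (f_ : (T -> \bar R)^nat) (f g : T -> \bar R) :
  (forall n, measurable_fun D (f_ n)) -> measurable_fun D g ->
  (forall n x, D x -> 0 <= f_ n x <= g x) -> \int[mu]_(x in D) g x < +oo ->
  (forall x, D x -> f_ n x @[n --> \oo] --> f x) ->
  \int[mu]_(x in D) f_ n x @[n --> \oo] --> \int[mu]_(x in D) f x.
Proof.
move=> mf_ mg f_g gy f_f.
have mf : measurable_fun D f by exact: (emeasurable_fun_cvg f_).
have g0 x : D x -> 0 <= g x.
  by move=> Dx; have /andP[] := f_g 0%N x Dx; exact: le_trans.
have [] := @dominated_convergence _ _ _ mu D mD f_ f g => //.
- exact: aeW.
- apply/integrableP; split=> //; rewrite (le_lt_trans _ gy)//.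
  rewrite le_eqVlt; apply/orP; left; apply/eqP/eq_integral => x /set_mem Dx.
  by rewrite gee0_abs ?g0.
- apply: aeW => x n Dx; have /andP[f0 fg] := f_g n x Dx.
  by rewrite gee0_abs.
Qed.

Lemma ge0_cvg_monotone (f_ : (T -> \bar R)^nat) (f : T -> \bar R) :
  (forall n, measurable_fun D (f_ n)) ->
  (forall n x, D x -> 0 <= f_ n x) ->
  (forall x, D x -> nondecreasing_seq (f_ ^~ x)) ->
  (forall x, D x -> f_ n x @[n --> \oo] --> f x) ->
  \int[mu]_(x in D) f_ n x @[n --> \oo] --> \int[mu]_(x in D) f x.
Proof.
move=> mf_ f0 ndf f_f.
rewrite (_ : \int[mu]_(x in D) f x = \int[mu]_(x in D) limn (f_ ^~ x)).
  exact: cvg_monotone_convergence.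
by apply: eq_integral => x /set_mem Dx; apply/esym/cvg_lim => //; exact: f_f.
Qed.

End convergence.

(** * Expectations of products of independent variables *)

Section independence.
Context d (T : measurableType d) (R : realType) (P : probability T R).
Import HBNNSimple.

(** Both sides are determined by the indicators [phi = \1_B]: by linearity they
    agree for simple [phi], and monotone convergence does the rest. *)
Lemma ge0_integral_comp_weighted (X : T -> R) (phi : R -> R) (G1 G2 : T -> R) :
  measurable_fun setT X -> measurable_fun setT phi -> (forall x, 0 <= phi x)%R ->
  measurable_fun setT G1 -> measurable_fun setT G2 ->
  (forall w, 0 <= G1 w)%R -> (forall w, 0 <= G2 w)%R ->
  (forall B, measurable B -> \int[P]_w (\1_B (X w) * G1 w)%:E =
                             \int[P]_w (\1_B (X w) * G2 w)%:E) ->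
  \int[P]_w (phi (X w) * G1 w)%:E = \int[P]_w (phi (X w) * G2 w)%:E.
Proof.
move=> mX mphi phi0 mG1 mG2 G10 G20 G12.
have mEphi : measurable_fun setT (EFin \o phi) by exact/measurable_EFinP.
pose g := nnsfun_approx measurableT mEphi.
have cvgG (G : T -> R) : measurable_fun setT G -> (forall w, 0 <= G w)%R ->
    \int[P]_w (g n (X w) * G w)%:E @[n --> \oo] --> \int[P]_w (phi (X w) * G w)%:E.
  move=> mG G0; apply: ge0_cvg_monotone => //.
  - move=> n; apply/measurable_EFinP/measurable_funM => //.
    by apply: measurableT_comp mX.
  - by move=> n w _; rewrite lee_fin mulr_ge0.
  - move=> w _ m n mn; rewrite lee_fin ler_wpM2r//.
    exact/lefP/nd_nnsfun_approx.
  - move=> w _; apply: cvg_EFin; first exact: nearW.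
    apply: (@cvgM R); last exact: cvg_cst.
    by have /fine_cvgP[_] := @cvg_nnsfun_approx _ _ _ _ measurableT _ mEphi
      (fun x _ => phi0 x) (X w) I.
have sumG (G : T -> R) n : measurable_fun setT G -> (forall w, 0 <= G w)%R ->
    \int[P]_w (g n (X w) * G w)%:E = \sum_(r <- finmap.enum_fset (fset_set (range (g n))))
      `|r|%:E * \int[P]_w (\1_(g n @^-1` [set r]) (X w) * G w)%:E.
  move=> mG G0.
  have mB r : measurable_fun setT
      (fun w => (\1_(g n @^-1` [set r]) (X w) * G w)%:E : \bar R).
    apply/measurable_EFinP/measurable_funM => //.
    apply: measurableT_comp mX; apply: measurable_indic.
    exact: measurable_funPTI.
  transitivity (\int[P]_w \sum_(r <- finmap.enum_fset (fset_set (range (g n))))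
      (`|r|%:E * (\1_(g n @^-1` [set r]) (X w) * G w)%:E)).
    apply: eq_integral => w _; rewrite (fimfunE (g n) (X w)).
    rewrite fsbig_finite//= mulr_suml -sumEFin; apply: eq_bigr => r _.
    rewrite -EFinM mulrA; congr ((_ * _)%:E).
    rewrite !indicE; have [/set_mem/= <-|_] := boolP (X w \in _); last by rewrite !mulr0.
    by rewrite ger0_norm.
  rewrite ge0_integral_sum//.
  - by apply: eq_bigr => r _; rewrite ge0_integralZl_EFin// => w _; rewrite lee_fin mulr_ge0.
  - by move=> r; exact: measurable_funeM.
  - by move=> r w _; rewrite mule_ge0// lee_fin// mulr_ge0.
apply/esym/(cvg_unique _ (cvgG _ mG2 G20)) => //.
suff -> : (fun n => \int[P]_w (g n (X w) * G2 w)%:E) =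
          (fun n => \int[P]_w (g n (X w) * G1 w)%:E) by exact: cvgG.
apply/funext => n; rewrite !sumG//; apply: eq_bigr => r _.
by rewrite G12//; exact: measurable_funPTI.
Qed.

(** Independence is the case where all the [f i] are indicators. The factors
    are turned into general functions one index after the other: with the
    other factors kept fixed as weights, [ge0_integral_comp_weighted] passes
    from indicators to functions in one position. *)
Lemma integral_prod_independent n (X : 'I_n -> T -> R) (f : 'I_n -> R -> R) :
  (forall i, measurable_fun setT (X i)) -> independent_RVs P X ->
  (forall i, measurable_fun setT (f i)) -> (forall i x, 0 <= f i x <= 1)%R ->
  \int[P]_w (\prod_(i < n) f i (X i w))%:E = \prod_(i < n) \int[P]_w (f i (X i w))%:E.
Proof.
move=> mX indX.
suff main k : (k <= n)%N -> forall f : 'I_n -> R -> R,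
    (forall i, measurable_fun setT (f i)) -> (forall i x, 0 <= f i x <= 1)%R ->
    (forall i : 'I_n, (k <= i)%N -> exists2 B, measurable B & f i = \1_B) ->
    \int[P]_w (\prod_(i < n) f i (X i w))%:E =
    \prod_(i < n) \int[P]_w (f i (X i w))%:E.
  move=> mf f01; apply: (main n) => // i.
  by rewrite leqNgt ltn_ord.
move=> {f}; elim: k => [_ f mf f01 find|k IH kn f mf f01 find].
  have /choice[B HB] : forall i, exists B, measurable B /\ f i = \1_B.
    by move=> i; have [B mB fB] := find i isT; exists B.
  have mXB i : measurable (X i @^-1` B i).
    by rewrite -[X in measurable X]setTI; apply: mX => //; exact: (HB i).1.
  rewrite (eq_integral (fun w => (\1_(\bigcap_(i in [set: 'I_n]) (X i @^-1` B i)) w)%:E)).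
    rewrite integral_indic//; last by apply: fin_bigcap_measurable.
    rewrite setIT; apply: etrans.
      by apply: indX => i; exact: (HB i).1.
    apply: eq_bigr => i _; rewrite (HB i).2.
    rewrite (eq_integral (fun w => (\1_(X i @^-1` B i) w)%:E))//.
    by rewrite integral_indic// setIT.
  move=> w _; congr EFin; rewrite indicE.
  have [/set_mem Xw|Xw] := boolP (w \in _).
    by rewrite big1// => i _; rewrite (HB i).2 indicE mem_set//; exact: Xw.
  have [i Bi] : exists i, ~ B i (X i w).
    by apply/existsNP => Xall; move/negP: Xw; apply; apply/mem_set => i _; exact: Xall.
  by rewrite (bigD1 i)//= (HB i).2 indicE memNset// mul0r.
pose i0 := Ordinal kn.
have f0 i x : (0 <= f i x)%R by have /andP[] := f01 i x.
have mfX i : measurable_fun setT (fun w => f i (X i w)) by apply: measurableT_comp (mX i).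
have [c c0 cE] : exists2 c : R, (0 <= c)%R &
    \prod_(i < n | i != i0) \int[P]_w (f i (X i w))%:E = c%:E.
  have int_ge0 i : 0 <= \int[P]_w (f i (X i w))%:E.
    by apply: integral_ge0 => w _; rewrite lee_fin.
  have : \prod_(i < n | i != i0) \int[P]_w (f i (X i w))%:E \is a fin_num.
    apply: prode_fin_num => i _; rewrite ge0_fin_numE//.
    apply: (@le_lt_trans _ _ (\int[P]_w (cst 1 w))).
      apply: ge0_le_integral => //; first by move=> w _; rewrite lee_fin.
      - exact/measurable_EFinP.
      - by move=> w _; rewrite lee_fin; have /andP[] := f01 i (X i w).
    rewrite integral_cst// mul1e.
    exact: (le_lt_trans (probability_le1 P measurableT) (ltry 1)).
  move=> /fineK <-; exists (fine (\prod_(i < n | i != i0)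
    \int[P]_w (f i (X i w))%:E)) => //.
  by apply: fine_ge0; apply: prode_ge0.
have key B : measurable B -> \int[P]_w (\1_B (X i0 w) * \prod_(i < n | i != i0) f i (X i w))%:E =
    \int[P]_w (\1_B (X i0 w) * c)%:E.
  move=> mB; pose fB i := if i == i0 then \1_B else f i.
  have fBi0 : fB i0 = \1_B by rewrite /fB eqxx.
  have fBi i : i != i0 -> fB i = f i by rewrite /fB => /negbTE ->.
  transitivity (\int[P]_w (\prod_(i < n) fB i (X i w))%:E).
    apply: eq_integral => w _; rewrite [in RHS](bigD1 i0)//= fBi0; congr (_ * _)%:E.
    by apply: eq_bigr => i /fBi ->.
  rewrite IH ?(ltnW kn)//.
  - rewrite (bigD1 i0)//= fBi0.
    rewrite (eq_bigr (fun i => \int[P]_w (f i (X i w))%:E)) => [|i /fBi ->]//.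
    rewrite cE -ge0_integralZr//.
    by apply/measurable_EFinP/measurableT_comp; [exact: measurable_indic|exact: mX].
  - by move=> i; rewrite /fB; case: ifP => // _; exact: measurable_indic.
  - move=> i x; rewrite /fB; case: ifP => // _.
    by rewrite indicE ler0n lern1 leq_b1.
  - move=> i ki; rewrite /fB; case: ifPn => [_|ii0]; first by exists B.
    apply: find; rewrite ltn_neqAle ki andbT; apply: contra ii0 => /eqP ki'.
    exact/eqP/val_inj.
rewrite (bigD1 i0)//= cE; under eq_integral do rewrite (bigD1 i0)//=.
have mG : measurable_fun setT (fun w => \prod_(i < n | i != i0) f i (X i w))%R.
  by under eq_fun do rewrite -big_filter; exact: measurable_prod.
rewrite (ge0_integral_comp_weighted (G2 := cst c)) => //.
- rewrite -ge0_integralZr//; first exact/measurable_EFinP.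
  by move=> w _; rewrite lee_fin.
- by move=> w; exact: prodr_ge0.
Qed.

End independence.

(** * The Laplace transform of the increments *)

Section increments.
Context d (T : measurableType d) (R : realType) (P : probability T R).
Variables (L : iap P) (alpha : {finite_measure set R -> \bar R}).
Variables (nu : R -> {measure set R -> \bar R}).
Variable (nut : {measure set (R * R) -> \bar R}).
Hypothesis nuL : has_levy_family P (reparam L alpha) nu.
Hypothesis nutE : is_poisson_intensity nu nut.

Definition jump_domain : set (R * R) := setT `*` `]0%R, +oo[.

Definition levy_exponent (f : R -> R) : \bar R :=
  \int[nut]_(z in jump_domain) (1 - expR (- (z.2 * f z.1)))%:E.

Lemma measurable_jump_domain : measurable jump_domain.
Proof. by apply: measurableX. Qed.

Lemma measurable_levy_integrand (f : R -> R) : measurable_fun setT f ->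
  measurable_fun setT (fun z : R * R => (1 - expR (- (z.2 * f z.1)))%:E).
Proof.
move=> mf; apply/measurable_EFinP/measurable_funB => //.
apply: measurableT_comp => //; apply: measurable_funN; apply: measurable_funM => //.
exact: measurableT_comp.
Qed.

Lemma measurable_1_sub_expR (c : R) :
  measurable_fun setT (fun v : R => (1 - expR (- (v * c)))%:E).
Proof.
apply/measurable_EFinP/measurable_funB => //; apply: measurableT_comp => //.
by apply: measurable_funN; exact: measurable_funM.
Qed.

Lemma one_sub_expR_ge0 (c v : R) : (0 <= c)%R -> (0 < v)%R ->
  0 <= (1 - expR (- (v * c)))%:E.
Proof.
move=> c0 /ltW v0.
by rewrite lee_fin subr_ge0 expR_le1 oppr_le0 mulr_ge0.
Qed.

Lemma levy_integrand_ge0 (f : R -> R) z : (forall x, 0 <= f x)%R ->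
  jump_domain z -> 0 <= (1 - expR (- (z.2 * f z.1)))%:E.
Proof.
move=> f0 [_]; rewrite /= in_itv/= andbT => z0.
by rewrite lee_fin subr_ge0 expR_le1 oppr_le0 mulr_ge0// ltW.
Qed.

(** The map [theta] sends [(y, v)] to [v] if [y <= x] and to [0] otherwise.
    The image of the intensity measure under [theta] agrees with [nu x] on
    [(0, +oo)], since the points sent to [0] are not seen there. *)
Lemma integral_poisson_intensity x (phi : R -> \bar R) :
  measurable_fun setT phi -> (forall v, (0 < v)%R -> 0 <= phi v) ->
  \int[nut]_(z in `]-oo, x] `*` `]0%R, +oo[) phi z.2 =
  \int[nu x]_(v in `]0%R, +oo[) phi v.
Proof.
move=> mphi phi0.
pose theta (z : R * R) : R := (\1_(`]-oo, x]%classic) z.1 * z.2)%R.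
have mtheta : measurable_fun setT theta.
  apply: measurable_funM; last exact: measurable_snd.
  by apply: measurableT_comp; [exact: measurable_indic|exact: measurable_fst].
have thetaC (C : set R) : C `<=` `]0%R, +oo[ ->
    theta @^-1` C = `]-oo, x] `*` C.
  move=> C0; apply/seteqP; split=> z /=; rewrite /theta.
    rewrite !indicE !mem_setE; case: (z.1 \in _) => /=; rewrite ?mul1r// mul0r.
    by move=> /C0; rewrite /= in_itv/= ltxx.
  by move=> [z1 z2]; rewrite indicE mem_set//= mul1r.
rewrite -thetaC//.
transitivity (\int[pushforward nut theta]_(v in `]0%R, +oo[) phi v).
  rewrite [RHS](ge0_integral_pushforward mtheta)//.
  - apply: eq_integral => z; rewrite thetaC// inE => -[z1 _] /=.
    by rewrite /theta indicE mem_set// mul1r.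
  - exact: measurable_funTS.
  - by move=> v; rewrite inE/= in_itv/= andbT; exact: phi0.
apply: eq_measure_integral => C mC C0.
by rewrite -(nutE x mC C0) -thetaC.
Qed.

(** The exponent of the function with value [c] on [A] and [0] elsewhere. *)
Definition levy_int (A : set R) (c : R) : \bar R :=
  \int[nut]_(z in A `*` `]0%R, +oo[) (1 - expR (- (z.2 * c)))%:E.

Lemma levy_int_ge0 A c : (0 <= c)%R -> 0 <= levy_int A c.
Proof.
move=> c0; apply: integral_ge0 => z [_ z0].
by apply: (@levy_integrand_ge0 (cst c)).
Qed.

Lemma levy_int_lower x c : (0 <= c)%R ->
  levy_int `]-oo, x] c = \int[nu x]_(v in `]0%R, +oo[) (1 - expR (- (v * c)))%:E.
Proof.
move=> c0; apply: (@integral_poisson_intensity x (fun v => (1 - expR (- (v * c)))%:E)).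
  exact: measurable_1_sub_expR.
by move=> v v0; exact: one_sub_expR_ge0.
Qed.

(** Up to the factor [c + 1], the integrand is at most [min v 1]. *)
Lemma levy_int_lty x c : (0 <= c)%R -> levy_int `]-oo, x] c < +oo.
Proof.
move=> c0; rewrite levy_int_lower//; have [levy _] := nuL x.
have m01 : measurable_fun (`]0%R, +oo[%classic : set R) (fun v : R => (Num.min v 1)%:E).
  by apply/measurable_EFinP/measurable_minr.
have min0 (v : R) : `]0%R, +oo[%classic v -> 0 <= (Num.min v 1 : R)%:E.
  by rewrite /= in_itv/= andbT => v0; rewrite lee_fin le_min ltW//=.
apply: (@le_lt_trans _ _ (\int[nu x]_(v in `]0%R, +oo[) ((c + 1)%:E * (Num.min v 1)%:E))).
  apply: ge0_le_integral => //.
  - by move=> v /=; rewrite in_itv/= andbT => v0; exact: one_sub_expR_ge0.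
  - exact: measurable_funTS (measurable_1_sub_expR c).
  - exact: measurable_funeM.
  - move=> v /=; rewrite in_itv/= andbT => v0; rewrite -EFinM lee_fin.
    case: (leP v 1%R) => v1.
      by have := expR_ge1Dx (- (v * c)); lra.
    by rewrite mulr1; have := expR_gt0 (- (v * c)); lra.
rewrite ge0_integralZl_EFin ?addr_ge0//.
by apply: lte_mul_pinfty => //; rewrite lee_fin addr_ge0.
Qed.

Lemma levy_int_itv x y c : (0 <= c)%R -> (x <= y)%R ->
  levy_int `]-oo, y] c = levy_int `]-oo, x] c + levy_int `]x, y] c.
Proof.
move=> c0 xy; rewrite /levy_int -ge0_integral_setU//.
- congr (\int[nut]_(z in _) _).
  rewrite (@itv_bndbnd_setU _ _ _ (BRight x))// ?bnd_simp//.
  apply/seteqP; split=> z /=; first by move=> [[h|h] hz]; [left|right].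
  by move=> [[h hz]|[h hz]]; split=> //; [left|right].
- exact: measurableX.
- exact: measurableX.
- apply: measurable_funTS.
  by apply: (@measurable_levy_integrand (cst c)).
- move=> z [] [_ z0]; exact: (@levy_integrand_ge0 (cst c)).
- rewrite disj_set2E; apply/eqP/seteqP; split=> // z [[/= + _] [+ _]].
  by rewrite !in_itv/= => zx /andP[]; rewrite ltNge zx.
Qed.

Lemma laplace_reparam x c : (0 <= c)%R ->
  \int[P]_w (expR (- (c * reparam L alpha x w)))%:E = expeR (- levy_int `]-oo, x] c).
Proof.
move=> c0; have [_ /(_ c c0)] := nuL x; rewrite unlock => ->.
rewrite (levy_int_lower x c0).
by under [in RHS]eq_integral do rewrite mulrC.
Qed.

Definition increment (x y : R) (w : T) : R := (reparam L alpha y w - reparam L alpha x w)%R.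

Lemma measurable_increment x y : measurable_fun setT (increment x y).
Proof. by apply: measurable_funB. Qed.

Lemma levy_int_itv_fin_num x y c : (0 <= c)%R -> (x <= y)%R ->
  levy_int `]x, y] c \is a fin_num.
Proof.
move=> c0 xy; rewrite ge0_fin_numE ?levy_int_ge0//.
rewrite (le_lt_trans _ (levy_int_lty y c0))// (levy_int_itv c0 xy).
by rewrite leeDr// levy_int_ge0.
Qed.

Lemma measurable_expR_max c :
  measurable_fun setT (fun u : R => expR (- (c * Num.max u 0%R))).
Proof.
apply: measurableT_comp => //; apply: measurable_funN; apply: measurable_funM => //.
exact: measurable_maxr.
Qed.

Lemma expR_max_itv01 (c u : R) : (0 <= c)%R ->
  (0 <= expR (- (c * Num.max u 0)) <= 1)%R.
Proof.
by move=> c0; rewrite expR_ge0 expR_le1 oppr_le0 mulr_ge0// le_max lexx orbT.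
Qed.

(** Increments are nonnegative, hence unchanged by [Num.max u 0]; this
    truncation makes [u |-> exp (- (c i * u))] bounded by [1] on the whole line,
    as [integral_prod_independent] demands. *)
Lemma laplace_increments n (y : nat -> R) (c : nat -> R) :
  (0 <= y 0%N)%R -> (forall i, y i <= y i.+1)%R -> (forall i, 0 <= c i)%R ->
  \int[P]_w (\prod_(i < n) expR (- (c i * (L (y i.+1) w - L (y i) w))))%:E =
  \prod_(i < n) \int[P]_w (expR (- (c i * (L (y i.+1) w - L (y i) w))))%:E.
Proof.
move=> y0 y_nd c0.
have yi i : (0 <= y i)%R by elim: i => // i; move/le_trans; apply.
have maxE i w : Num.max (L (y i.+1) w - L (y i) w)%R 0%R = (L (y i.+1) w - L (y i) w)%R.
  by apply/max_idPl; rewrite subr_ge0 iap_nondecreasing.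
have := @integral_prod_independent _ _ _ P n
  (fun i w => L (y i.+1) w - L (y i) w)%R (fun i u => expR (- (c i * Num.max u 0)))%R.
under eq_integral do under eq_bigr do rewrite maxE.
move=> ->.
- by apply: eq_bigr => i _; under eq_integral do rewrite maxE.
- by move=> i; apply: measurable_funB.
- exact: iap_independent_increments.
- by move=> i; exact: measurable_expR_max.
- by move=> i x; exact: expR_max_itv01.
Qed.

(** As [L 0 = 0], the value of [L_A] at [y] is the sum of the independent
    increments of [L] over the times [0, A x, A y]; the transform of the second
    one is a quotient because the exponent at [x] is finite. *)
Lemma laplace_increment x y c : (0 <= c)%R -> (x <= y)%R ->
  \int[P]_w (expR (- (c * increment x y w)))%:E = expeR (- levy_int `]x, y] c).
Proof.
move=> c0 xy.
pose t (i : nat) : R := match i with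
  0 => 0%R | 1 => dist_fun alpha x | _ => dist_fun alpha y end.
have t_nd i : (t i <= t i.+1)%R.
  by case: i => [|[|i]] //=; [exact: dist_fun_ge0|exact: dist_fun_nondecreasing].
have := @laplace_increments 2 t (fun=> c) (lexx _) t_nd (fun=> c0).
rewrite !big_ord_recl !big_ord0 mule1.
under eq_integral do rewrite !big_ord_recl big_ord0 mulr1/= iap_start subr0 -expRD
  -opprD -mulrDr addrC subrK.
under [X in _ = X * _]eq_integral do rewrite /= iap_start subr0.
rewrite (laplace_reparam y c0) (laplace_reparam x c0) (levy_int_itv c0 xy).
have fx : levy_int `]-oo, x] c \is a fin_num.
  by rewrite ge0_fin_numE ?levy_int_ge0// levy_int_lty.
rewrite fin_num_oppeD ?levy_int_itv_fin_num// expeRD.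
move=> /(congr1 (fun z => expeR (levy_int `]-oo, x] c) * z)) /=.
by rewrite !muleA -!expeRD subee// add0e expeR0 mul1e => <-.
Qed.

Lemma laplace_step s h : step_on s h -> (forall x, 0 <= h x)%R ->
  \int[P]_w (expR (- \sum_(i < (size s).-1)
    (h (grid s i.+1) * increment (grid s i) (grid s i.+1) w)))%:E =
  expeR (- \sum_(i < (size s).-1) levy_int `]grid s i, grid s i.+1] (h (grid s i.+1))).
Proof.
move=> sh h0.
under eq_integral do rewrite -sumrN expR_sum.
rewrite (@laplace_increments _ (fun i => dist_fun alpha (grid s i)) (fun i => h (grid s i.+1)))//.
- rewrite -fin_num_sumeN; last first.
    by move=> i _; rewrite levy_int_itv_fin_num// grid_nondecreasing.
  rewrite (big_morph expeR (@expeRD R) (@expeR0 R)); apply: eq_bigr => i _.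
  by rewrite -laplace_increment// grid_nondecreasing.
- exact: dist_fun_ge0.
- by move=> i; apply: dist_fun_nondecreasing; exact: grid_nondecreasing.
Qed.

End increments.

Arguments jump_domain {R}.

(** * The Laplace functional *)

Section extended_exponential.
Context {R : realType}.

(** [er_map expR] differs from [expeR] only at [-oo], which it fixes. *)
Lemma measurable_expeR : measurable_fun setT (@expeR R).
Proof.
rewrite (_ : @expeR R = fun x => maxe (er_map expR x) 0).
  apply: measurable_maxe => //.
  exact: (@measurable_er_map _ R R expR (@measurable_expR R)).
apply/funext => -[r| |] /=.
- by apply/esym/max_idPl; rewrite lee_fin expR_ge0.
- by apply/esym/max_idPl; rewrite leey.
- by apply/esym/max_idPr; rewrite leNye.
Qed.

Lemma cvg_expeRN (u : (\bar R)^nat) l : 0 <= l -> u n @[n --> \oo] --> l ->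
  expeR (- u n) @[n --> \oo] --> expeR (- l).
Proof.
case: l => [r _ /fine_cvgP[ufin ur]|_ /cvgeyPge uy|//].
  apply/fine_cvgP; split.
    by apply: filterS ufin => n; case: (u n).
  apply: (@cvg_trans _ (expR (- fine (u n)) @[n --> \oo])).
    apply: near_eq_cvg; apply: filterS ufin => n /=.
    by case: (u n).
  exact: (cvg_comp _ _ (@cvgN _ R^o _ _ _ _ _ ur) (@continuous_expR R _)).
have u0 : \forall n \near \oo, 0 <= u n by exact: uy.
apply/fine_cvgP; split.
  by apply: filterS u0 => n; case: (u n).
apply/cvgr0Pnorm_le => e e0.
apply: filterS2 u0 (uy (- ln e)%R) => n /=.
case: (u n) => [r| |]//=; last by move=> _ _; rewrite normr0 ltW.
rewrite !lee_fin => _ er; rewrite ger0_norm ?expR_ge0//.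
by rewrite -[leRHS]lnK// ler_expR lerNl.
Qed.

End extended_exponential.

Section laplace_functional.
Context d (T : measurableType d) (R : realType) (P : probability T R).
Variables (L : iap P) (alpha : {finite_measure set R -> \bar R}).
Variables (nu : R -> {measure set R -> \bar R}).
Variable (nut : {measure set (R * R) -> \bar R}).
Hypothesis nuL : has_levy_family P (reparam L alpha) nu.
Hypothesis nutE : is_poisson_intensity nu nut.

Lemma stieltjes_reparam_itv w x y : (x <= y)%R ->
  lebesgue_stieltjes_measure (reparam_path L alpha w) (`]x, y]%classic) =
  (increment L alpha x y w)%:E.
Proof.
move=> xy; rewrite /lebesgue_stieltjes_measure /measure_extension/=.
rewrite measurable_mu_extE/=; last by exists (x, y).
by rewrite wlength_itv_bnd.
Qed.

Lemma reparam_integral_ge0 f w : (forall x, 0 <= f x)%R ->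
  0 <= reparam_integral L alpha f w.
Proof. by move=> f0; apply: integral_ge0 => x _; rewrite lee_fin. Qed.

Lemma levy_exponent_ge0 f : (forall x, 0 <= f x)%R -> 0 <= levy_exponent nut f.
Proof. by move=> f0; apply: integral_ge0 => z; exact: levy_integrand_ge0. Qed.

Lemma reparam_integral_step s h w : step_on s h -> (forall x, 0 <= h x)%R ->
  reparam_integral L alpha h w = (\sum_(i < (size s).-1)
    (h (grid s i.+1) * increment L alpha (grid s i) (grid s i.+1) w))%:E.
Proof.
move=> sh h0; rewrite /reparam_integral.
transitivity (\int[lebesgue_stieltjes_measure (reparam_path L alpha w)]_x
  \sum_(i < (size s).-1) ((h (grid s i.+1))%:E *
    (\1_(`]grid s i, grid s i.+1]%classic) x)%:E)).
  by apply: eq_integral => x _; rewrite (step_onE sh x) -sumEFin.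
rewrite ge0_integral_sum//.
- rewrite -sumEFin; apply: eq_bigr => i _.
  rewrite ge0_integralZl_EFin//; last by apply/measurable_EFinP/measurable_indic.
  rewrite integral_indic// setIT EFinM; congr (_ * _).
  exact/stieltjes_reparam_itv/grid_nondecreasing.
- move=> i; apply: measurable_funeM; apply/measurable_EFinP.
  exact: measurable_indic.
- by move=> i x _; rewrite mule_ge0 ?lee_fin.
Qed.

(** Composing [h] with [u |-> 1 - exp (- (v * u))], which vanishes at [0], gives a
    step function with the same cells. *)
Lemma levy_exponent_step s h : step_on s h -> (forall x, 0 <= h x)%R ->
  levy_exponent nut h = \sum_(i < (size s).-1)
    levy_int nut `]grid s i, grid s i.+1] (h (grid s i.+1)).
Proof.
move=> sh h0; rewrite /levy_exponent.
pose F (i : 'I_(size s).-1) (z : R * R) : \bar R :=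
  ((fun z => (1 - expR (- (z.2 * h (grid s i.+1))))%:E)
    \_ ((`]grid s i, grid s i.+1]%classic : set R) `*` setT)) z.
have mI i : measurable ((`]grid s i, grid s i.+1]%classic : set R) `*` (setT : set R)).
  exact: measurableX.
transitivity (\int[nut]_(z in jump_domain) \sum_(i < (size s).-1) F i z).
  apply: eq_integral => z _.
  have phi0 : (1 - expR (- (z.2 * 0)) = 0 :> R)%R by rewrite mulr0 oppr0 expR0 subrr.
  have /= -> := step_onE (step_on_comp (phi := fun u => 1 - expR (- (z.2 * u)))%R phi0 sh) z.1.
  rewrite -sumEFin; apply: eq_bigr => i _.
  rewrite /F epatch_indic/= EFinM !indicE; congr (_ * (_%:R)%:E).
  by rewrite in_setX in_setT andbT.
rewrite ge0_integral_sum//.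
- apply: eq_bigr => i _; rewrite /F -integral_mkcondr /levy_int; congr (\int[nut]_(z in _) _).
  by apply/seteqP; split => z /=; rewrite /jump_domain/=; tauto.
- exact: measurable_jump_domain.
- move=> i; apply: measurable_funTS; apply/(measurable_restrictT _ (mI i)).
  apply: measurable_funTS.
  by apply: (@measurable_levy_integrand R (fun=> h (grid s i.+1))).
- move=> i z Dz; rewrite /F patchE; case: ifP => _; last exact: lexx.
  by apply: (@levy_integrand_ge0 R (fun=> h (grid s i.+1))).
Qed.

(** Measurability of the random integral is included, since it is obtained by
    the same induction. *)
Definition laplace_formula (f : R -> R) :=
  measurable_fun setT (reparam_integral L alpha f) /\
  \int[P]_w expeR (- reparam_integral L alpha f w) = expeR (- levy_exponent nut f).

Lemma laplace_formula_cvg (f_ : nat -> R -> R) f :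
  (forall n x, 0 <= f_ n x)%R -> (forall x, 0 <= f x)%R ->
  (forall w, reparam_integral L alpha (f_ n) w @[n --> \oo] --> reparam_integral L alpha f w) ->
  levy_exponent nut (f_ n) @[n --> \oo] --> levy_exponent nut f ->
  (forall n, laplace_formula (f_ n)) -> laplace_formula f.
Proof.
move=> f_0 f0 If Jf Qf.
have mI : measurable_fun setT (reparam_integral L alpha f).
  by apply: (emeasurable_fun_cvg _ _ (fun n => (Qf n).1)) => w _; exact: If.
split=> //.
have mE g : measurable_fun setT (reparam_integral L alpha g) ->
    measurable_fun setT (fun w => expeR (- reparam_integral L alpha g w)).
  move=> mg; apply: (measurableT_comp measurable_expeR).
  exact: measurableT_comp.
have lhs : \int[P]_w expeR (- reparam_integral L alpha (f_ n) w) @[n --> \oo] -->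
    \int[P]_w expeR (- reparam_integral L alpha f w).
  apply: (@ge0_cvg_dominated _ _ _ _ _ _ _ _ (cst 1)) => //.
  - by move=> n; apply: mE; exact: (Qf n).1.
  - move=> n w _; rewrite expeR_ge0 -[leRHS]expeR0 lee_expeR leeNl oppe0.
    exact: reparam_integral_ge0.
  - by rewrite integral_cst// mul1e (le_lt_trans (probability_le1 P _)) ?ltry.
  - move=> w _; apply: cvg_expeRN => //; exact: reparam_integral_ge0.
have rhs : expeR (- levy_exponent nut (f_ n)) @[n --> \oo] --> expeR (- levy_exponent nut f).
  by apply: cvg_expeRN => //; exact: levy_exponent_ge0.
rewrite (funext (fun n => (Qf n).2)) in lhs.
by rewrite (cvg_unique _ lhs rhs).
Qed.

Lemma cvg_levy_integrand (f_ : nat -> R -> R) f (z : R * R) :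
  f_ n z.1 @[n --> \oo] --> f z.1 ->
  (1 - expR (- (z.2 * f_ n z.1)))%:E @[n --> \oo] --> (1 - expR (- (z.2 * f z.1)))%:E.
Proof.
move=> ff; apply: cvg_EFin; first exact: nearW.
apply: (@cvgB _ R^o); first exact: cvg_cst.
have zf : (z.2 * f_ n z.1)%R @[n --> \oo] --> (z.2 * f z.1)%R.
  by apply: (@cvgM R) => //; exact: cvg_cst.
exact: (cvg_comp _ _ (@cvgN _ R^o _ _ _ _ _ zf) (@continuous_expR R _)).
Qed.

Lemma le_levy_integrand (f g : R -> R) (z : R * R) : jump_domain z ->
  (f z.1 <= g z.1)%R ->
  (1 - expR (- (z.2 * f z.1)))%:E <= (1 - expR (- (z.2 * g z.1)))%:E.
Proof.
move=> [_]; rewrite /= in_itv/= andbT => z0 fg.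
by rewrite lee_fin lerD2l lerN2 ler_expR lerN2 ler_wpM2l// ltW.
Qed.

Lemma cvg_levy_exponent_dominated (f_ : nat -> R -> R) (f g : R -> R) :
  (forall n, measurable_fun setT (f_ n)) -> measurable_fun setT g ->
  (forall n x, 0 <= f_ n x <= g x)%R -> levy_exponent nut g < +oo ->
  (forall x, f_ n x @[n --> \oo] --> f x) ->
  levy_exponent nut (f_ n) @[n --> \oo] --> levy_exponent nut f.
Proof.
move=> mf_ mg fg gy ff; rewrite /levy_exponent.
apply: (@ge0_cvg_dominated _ _ _ nut jump_domain (@measurable_jump_domain R)
  (fun n z => (1 - expR (- (z.2 * f_ n z.1)))%:E)
  (fun z => (1 - expR (- (z.2 * f z.1)))%:E)
  (fun z => (1 - expR (- (z.2 * g z.1)))%:E)) => //.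
- by move=> n; apply: measurable_funTS; exact: measurable_levy_integrand.
- by apply: measurable_funTS; exact: measurable_levy_integrand.
- move=> n z Dz; have /andP[f0 {}fg] := fg n z.1.
  rewrite (le_levy_integrand Dz fg) andbT.
  by apply: (@levy_integrand_ge0 R (fun=> f_ n z.1)).
- by move=> z _; exact: cvg_levy_integrand.
Qed.

Lemma cvg_levy_exponent_monotone (f_ : nat -> R -> R) (f : R -> R) :
  (forall n, measurable_fun setT (f_ n)) -> (forall n x, 0 <= f_ n x)%R ->
  (forall x, nondecreasing_seq (f_ ^~ x)) ->
  (forall x, f_ n x @[n --> \oo] --> f x) ->
  levy_exponent nut (f_ n) @[n --> \oo] --> levy_exponent nut f.
Proof.
move=> mf_ f_0 ndf ff; rewrite /levy_exponent.
apply: (@ge0_cvg_monotone _ _ _ nut jump_domain (@measurable_jump_domain R)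
  (fun n z => (1 - expR (- (z.2 * f_ n z.1)))%:E)
  (fun z => (1 - expR (- (z.2 * f z.1)))%:E)).
- by move=> n; apply: measurable_funTS; exact: measurable_levy_integrand.
- by move=> n z Dz; exact: levy_integrand_ge0.
- by move=> z Dz m n mn; apply: le_levy_integrand => //; exact: ndf.
- by move=> z _; exact: cvg_levy_integrand.
Qed.

Lemma cvg_reparam_integral_dominated w (f_ : nat -> R -> R) (f g : R -> R) :
  (forall n, measurable_fun setT (f_ n)) -> measurable_fun setT g ->
  (forall n x, 0 <= f_ n x <= g x)%R -> reparam_integral L alpha g w < +oo ->
  (forall x, f_ n x @[n --> \oo] --> f x) ->
  reparam_integral L alpha (f_ n) w @[n --> \oo] --> reparam_integral L alpha f w.
Proof.
move=> mf_ mg fg gy ff; rewrite /reparam_integral.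
apply: (@ge0_cvg_dominated _ _ _
  (lebesgue_stieltjes_measure (reparam_path L alpha w)) setT measurableT
  (fun n x => (f_ n x)%:E) (fun x => (f x)%:E) (EFin \o g)) => //.
- by move=> n; apply/measurable_EFinP; exact: mf_.
- exact/measurable_EFinP.
- by move=> n x _; rewrite /= !lee_fin fg.
- by move=> x _; apply: cvg_EFin; [exact: nearW|exact: ff].
Qed.

Lemma cvg_reparam_integral_monotone w (f_ : nat -> R -> R) (f : R -> R) :
  (forall n, measurable_fun setT (f_ n)) -> (forall n x, 0 <= f_ n x)%R ->
  (forall x, nondecreasing_seq (f_ ^~ x)) ->
  (forall x, f_ n x @[n --> \oo] --> f x) ->
  reparam_integral L alpha (f_ n) w @[n --> \oo] --> reparam_integral L alpha f w.
Proof.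
move=> mf_ f_0 ndf ff; rewrite /reparam_integral.
apply: (@ge0_cvg_monotone _ _ _
  (lebesgue_stieltjes_measure (reparam_path L alpha w)) setT measurableT
  (fun n x => (f_ n x)%:E) (fun x => (f x)%:E)) => //.
- by move=> n; apply/measurable_EFinP; exact: mf_.
- by move=> n x _; rewrite lee_fin.
- by move=> x _ m n mn; rewrite lee_fin; exact: ndf.
- by move=> x _; apply: cvg_EFin; [exact: nearW|exact: ff].
Qed.

Lemma laplace_functional (f : R -> R) : measurable_fun setT f ->
  (forall x, 0 <= f x)%R -> laplace_formula f.
Proof.
apply: step_function_induction => [s h sh h0|f_ {}f s g mf_ sg fg ff Qf|f_ {}f mf_ f_0 ndf ff Qf].
- split; rewrite (funext (fun w => reparam_integral_step w sh h0)).
    apply/measurable_EFinP/measurable_sum => i; apply: measurable_funM => //.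
    exact: measurable_increment.
  by rewrite (levy_exponent_step sh h0) -(laplace_step nuL nutE sh h0).
- have f0 x : (0 <= f x)%R.
    by apply: (cvgr_to_ge (ff x)); apply: nearW => n; have /andP[] := fg n x.
  have f_0 n x : (0 <= f_ n x)%R by have /andP[] := fg n x.
  have g0 x : (0 <= g x)%R by apply: le_trans (f_0 0%N x) _; have /andP[] := fg 0%N x.
  have mg := measurable_step_on sg.
  apply: (@laplace_formula_cvg f_ f) => // [w|].
    apply: (cvg_reparam_integral_dominated mf_ mg) => //.
    by rewrite (reparam_integral_step w sg g0) ltry.
  apply: (cvg_levy_exponent_dominated mf_ mg) => //.
  rewrite (levy_exponent_step sg g0).
  apply: lte_sum_pinfty => i _; rewrite ltey_eq (levy_int_itv_fin_num nuL nutE)//.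
  exact: grid_nondecreasing.
- have f0 x : (0 <= f x)%R by apply: (cvgr_to_ge (ff x)); apply: nearW => n.
  apply: (@laplace_formula_cvg f_ f) => // [w|].
    exact: cvg_reparam_integral_monotone.
  exact: cvg_levy_exponent_monotone.
Qed.

End laplace_functional.

(** * Limits along a path and measurability of quotients *)

Section pathwise_limits.
Context {R : realType}.

Lemma nondecreasing_cvge_pinfty (f : R -> \bar R) (l : \bar R) :
  {homo f : s t / (s <= t)%R >-> s <= t} -> (forall t, f t <= l) ->
  f n%:R%R @[n --> \oo] --> l -> f t @[t --> +oo%R] --> l.
Proof.
move=> ndf fl fnl.
have truncy : Num.truncn t @[t --> (+oo%R : set_system R)] --> \oo.
  apply/cvgnyPge => A; near=> t.
  have At : (A%:R <= t)%R by near: t; exact: nbhs_pinfty_ge.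
  by rewrite truncn_ge_nat// (le_trans _ At).
apply: (@squeeze_cvge _ _ _ _ (fun t => f (Num.truncn t)%:R%R) _ (cst l));
  [|exact: (cvg_comp _ _ truncy fnl)|exact: cvg_cst].
near=> t; rewrite fl andbT; apply: ndf.
by rewrite truncn_le//; near: t; exact: nbhs_pinfty_ge.
Unshelve. all: by end_near. Qed.

Lemma measurable_inve d (T : measurableType d) (X : T -> \bar R) :
  measurable_fun setT X -> (forall w, 0 <= X w) ->
  measurable_fun setT (fun w => (X w)^-1).
Proof.
move=> mX X0.
rewrite (_ : (fun w => _) = fun w => if X w == 0 then +oo
    else ((fine (X w)) `^ (-1))%:E); last first.
  apply/funext => w; have := X0 w; case: (X w) => [r| |]//= r0.
  - rewrite inver eqe; case: ifPn => // _.
    by rewrite powR_inv1.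
  - by rewrite invey powR0// oppr_eq0 oner_eq0.
apply: measurable_fun_ifT => //; first exact: measurable_fun_eqe.
apply/measurable_EFinP; apply: (measurableT_comp (@measurable_powR R (-1))).
exact: (measurableT_comp (fine_measurable measurableT)).
Qed.

End pathwise_limits.

(** * Almost sure finiteness and positivity *)

Section positivity_and_finiteness.
Context d (T : measurableType d) (R : realType) (P : probability T R).
Variables (L : iap P) (alpha : {finite_measure set R -> \bar R}).
Variables (nu : R -> {measure set R -> \bar R}).
Variable (nut : {measure set (R * R) -> \bar R}).
Hypothesis nuL : has_levy_family P (reparam L alpha) nu.
Hypothesis nutE : is_poisson_intensity nu nut.
Variable f : R -> R.
Hypothesis mf : measurable_fun setT f.
Hypothesis f0 : forall x, (0 <= f x)%R.

Let I := reparam_integral L alpha f.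

Let laplace_scaled (c : R) : (0 <= c)%R ->
  \int[P]_w expeR (- (c%:E * I w)) = expeR (- levy_exponent nut (fun x => c * f x)%R).
Proof.
move=> c0.
have mcf : measurable_fun setT (fun x => c * f x)%R by exact: measurable_funM.
have [_ <-] : laplace_formula L alpha nut (fun x => c * f x)%R.
  by apply: (laplace_functional nuL nutE mcf) => x; rewrite mulr_ge0.
apply: eq_integral => w _; rewrite /I /reparam_integral -ge0_integralZl_EFin//.
- by move=> x _; rewrite lee_fin.
- exact/measurable_EFinP.
Qed.

Let mI : measurable_fun setT I.
Proof. by have [] := laplace_functional nuL nutE mf f0. Qed.

Let I0 w : 0 <= I w.
Proof. exact: reparam_integral_ge0. Qed.

Let mexp (c : R) : measurable_fun setT (fun w => expeR (- (c%:E * I w))).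
Proof.
apply: (measurableT_comp measurable_expeR); apply: measurableT_comp => //.
exact: measurable_funeM.
Qed.

(** Where [I] is infinite, so is [c * I] for every [c > 0], hence
    [exp (- J (c * f)) = E (exp (- (c * I))) <= P (I < +oo)]; the left side tends to
    [1] as [c] goes to [0]. *)
Lemma ae_reparam_integral_lty : levy_exponent nut f < +oo ->
  {ae P, forall w, I w < +oo}.
Proof.
move=> Jf; pose A := I @^-1` [set +oo].
have mA : measurable A by rewrite -[A]setTI; apply: mI => //; exact: emeasurable_set1.
exists A; split=> //; last by move=> w /= /negP; rewrite -leNgt leye_eq => /eqP.
pose c n : R := (n.+1%:R^-1)%R.
have c_gt0 n : (0 < c n)%R by rewrite invr_gt0.
have Jc : levy_exponent nut (fun x => c n * f x)%R @[n --> \oo] --> 0.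
  rewrite (_ : 0 = levy_exponent nut (cst 0%R)); last first.
    rewrite /levy_exponent integral0_eq// => z _.
    by rewrite mulr0 oppr0 expR0 subrr.
  apply: (cvg_levy_exponent_dominated _ mf) => //.
  - by move=> n; exact: measurable_funM.
  - move=> n x; rewrite mulr_ge0 ?(ltW (c_gt0 n))//= ler_piMl// invf_le1// ler1n//.
  - move=> x; rewrite -[cst 0%R x](mul0r (f x)); apply: (@cvgM R); last exact: cvg_cst.
    exact: cvg_harmonic.
have eJ : expeR (- levy_exponent nut (fun x => c n * f x)%R) @[n --> \oo] --> 1.
  by have := cvg_expeRN (lexx 0) Jc; rewrite oppe0 expeR0.
have le1 n : expeR (- levy_exponent nut (fun x => c n * f x)%R) <= P (~` A).
  rewrite -(laplace_scaled (ltW (c_gt0 n))).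
  have -> : P (~` A) = \int[P]_w (\1_(~` A) w)%:E.
    by rewrite integral_indic ?setIT//; exact: measurableC.
  apply: ge0_le_integral => //.
  - by move=> w _; exact: expeR_ge0.
  - by apply/measurable_EFinP/measurable_indic; exact: measurableC.
  - move=> w _; rewrite indicE; have [/set_mem wA|] := boolP (w \in ~` A).
      rewrite -[leRHS]expeR0 lee_expeR leeNl oppe0 mule_ge0// lee_fin.
      exact: ltW.
    rewrite in_setC negbK => /set_mem ->.
    by rewrite gt0_muley ?lte_fin.
have : 1 <= P (~` A) by apply: (cvge_to_le eJ); exact: nearW.
rewrite probability_setC// -(fineK (fin_num_measure P A mA)) -EFinB lee_fin => PA.
congr EFin; apply/eqP; rewrite eq_le fine_ge0// andbT.
by lra.
Qed.

(** For all [n], [P (I = 0) <= E (exp (- (n * I))) = exp (- J (n * f))], and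
    [J (n * f)] increases to the intensity of [{f > 0} * (0, +oo)]. *)
Lemma ae_reparam_integral_gt0 : nut ([set x | (0 < f x)%R] `*` `]0%R, +oo[) = +oo ->
  {ae P, forall w, 0 < I w}.
Proof.
move=> nutf; pose A := I @^-1` [set 0].
have mA : measurable A by rewrite -[A]setTI; apply: mI => //; exact: emeasurable_set1.
exists A; split=> //; last first.
  by move=> w /= /negP; rewrite -leNgt => Iw; apply/eqP; rewrite eq_le Iw I0.
have mpos : measurable [set x | (0 < f x)%R].
  rewrite (_ : [set x | _] = setT `&` f @^-1` `]0%R, +oo[); first exact: mf.
  by apply/seteqP; split=> x /=; rewrite in_itv/= andbT// => -[].
have Jy : levy_exponent nut (fun x => n%:R * f x)%R @[n --> \oo] --> +oo.
  have -> : +oo = \int[nut]_(z in jump_domain)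
      (\1_([set x | (0 < f x)%R] `*` setT) z : R)%:E.
    rewrite integral_indic; [|exact: measurable_jump_domain|exact: measurableX].
    by rewrite -nutf; congr (nut _); apply/seteqP; split=> z /=; rewrite /jump_domain/=; tauto.
  apply: (@ge0_cvg_monotone _ _ _ nut jump_domain (@measurable_jump_domain R)
    (fun n z => (1 - expR (- (z.2 * (n%:R * f z.1))))%:E)
    (fun z => (\1_([set x | (0 < f x)%R] `*` setT) z : R)%:E)).
  - move=> n; apply: measurable_funTS.
    by apply: (@measurable_levy_integrand R (fun x => n%:R * f x)%R); exact: measurable_funM.
  - move=> n z Dz; apply: (@levy_integrand_ge0 R (fun x => n%:R * f x)%R) => // x.
    by rewrite mulr_ge0.
  - move=> z Dz m n mn.
    apply: (@le_levy_integrand _ (fun x => m%:R * f x)%R (fun x => n%:R * f x)%R) => //.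
    by rewrite ler_wpM2r// ler_nat.
  - move=> z [_ /=]; rewrite in_itv/= andbT => z0.
    have [fz|] := ltP 0%R (f z.1).
      rewrite indicE mem_set//= -[1%:E]sube0; apply: cvg_EFin; first exact: nearW.
      apply: (@cvgB _ R^o); first exact: cvg_cst.
      under eq_cvg do rewrite mulrCA -mulrN expRM_natl.
      apply: cvg_expr; rewrite ger0_norm ?expR_ge0// expR_lt1 oppr_lt0.
      exact: mulr_gt0.
    move=> fz; rewrite indicE memNset/=; last by case; rewrite ltNge fz.
    have -> : f z.1 = 0%R by apply/eqP; rewrite eq_le fz f0.
    by apply: cvg_near_cst; apply: nearW => n; rewrite !mulr0 oppr0 expR0 subrr.
have eJ : expeR (- levy_exponent nut (fun x => n%:R * f x)%R) @[n --> \oo] --> 0.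
  exact: (cvg_expeRN (leey 0) Jy).
have le1 n : P A <= expeR (- levy_exponent nut (fun x => n%:R * f x)%R).
  rewrite -(laplace_scaled (ler0n R n)).
  have -> : P A = \int[P]_w (\1_A w)%:E by rewrite integral_indic ?setIT.
  apply: ge0_le_integral => //.
  - exact/measurable_EFinP/measurable_indic.
  - move=> w _; rewrite indicE; have [/set_mem wA|_] := boolP (w \in A).
      by rewrite wA mule0 oppe0 expeR0.
    exact: expeR_ge0.
apply/eqP; rewrite eq_le measure_ge0 andbT.
by apply: (cvge_to_ge eJ); exact: nearW.
Qed.

End positivity_and_finiteness.

(** * Random distribution functions *)

Theorem mainTheorem1 (R : realType) (d : measure_display)
    (Omega : measurableType d) (P : probability Omega R)
    (L : iap P)
    (a : R) (a_gt0 : (0 < a)%R)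
    (alpha : {finite_measure set R -> \bar R})
    (alpha_mass : alpha setT = a%:E) (alpha_nd : nondegenerate_measure alpha)
    (nu : R -> {measure set R -> \bar R})
    (nuL : has_levy_family P (reparam L alpha) nu)
    (nut : {measure set (R * R) -> \bar R})
    (nutE : is_poisson_intensity nu nut)
    (k : R -> R -> R) (k_ge0 : forall t x, (0 <= k t x)%R)
    (k_meas : forall t, measurable_fun setT (k t))
    (kbar : R -> R)
    (kbarE : forall x, k t x @[t --> +oo%R] --> kbar x)
    (condI : forall x : R,
      [/\ {homo k ^~ x : s t / (s <= t)%R},
          right_continuous (k ^~ x) &
          k t x @[t --> -oo%R] --> 0%R])
    (condII : forall lambda : R, (0 < lambda)%R ->
      \int[nut]_(z in setT `*` `]0%R, +oo[)
        (1 - expR (- (lambda * z.2 * kbar z.1)))%:E < +oo)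
    (condIII : nut (setT `*` `]0%R, +oo[) = +oo)
    (* P(Zbar = 0) = exp(- nut({kbar > 0} * (0, +oo))), and condI--condIII do
       not exclude e.g. k = 0 *)
    (condIII_kbar : nut ([set x | (0 < kbar x)%R] `*` `]0%R, +oo[) = +oo) :
  let Z := fun (t : R) (w : Omega) => reparam_integral L alpha (k t) w in
  let Zbar := fun w : Omega => lim (Z t w @[t --> +oo%R]) in
  let F := fun (t : R) (w : Omega) => Z t w / Zbar w in
  as_random_df P Z /\ as_random_pdf P F.
Proof.
move=> Z Zbar F.
have k_nd x : {homo k ^~ x : s t / (s <= t)%R} by have [] := condI x.
have k_rc x : right_continuous (k ^~ x) by have [] := condI x.
have k_Ny x : k t x @[t --> -oo%R] --> 0%R by have [] := condI x.
have k_nat x : k n%:R%R x @[n --> \oo] --> kbar x.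
  exact: (cvg_comp _ _ (@cvgr_idn R) (kbarE x)).
have k_le t x : (k t x <= kbar x)%R.
  apply: (cvgr_to_ge (kbarE x)); near=> s; apply: k_nd.
  by near: s; apply: nbhs_pinfty_ge; exact: num_real.
have kbar0 x : (0 <= kbar x)%R by exact: le_trans (k_ge0 0%R x) (k_le 0%R x).
have mkbar : measurable_fun setT kbar.
  by apply: (measurable_fun_cvg (fun n => k_meas n%:R%R)) => x _; exact: k_nat.
pose I := reparam_integral L alpha kbar.
have mZ t : measurable_fun setT (Z t).
  by have [] := laplace_functional nuL nutE (k_meas t) (k_ge0 t).
have mI : measurable_fun setT I.
  by have [] := laplace_functional nuL nutE mkbar kbar0.
have Z0 t w : 0 <= Z t w by exact: reparam_integral_ge0.
have Z_nd w : {homo Z ^~ w : s t / (s <= t)%R >-> s <= t}.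
  move=> s t st; apply: ge0_le_integral => //.
  - by move=> x _; rewrite lee_fin.
  - by apply/measurable_EFinP; exact: k_meas.
  - by apply/measurable_EFinP; exact: k_meas.
  - by move=> x _; rewrite lee_fin k_nd.
have Z_le t w : Z t w <= I w.
  apply: ge0_le_integral => //.
  - by move=> x _; rewrite lee_fin.
  - by apply/measurable_EFinP; exact: k_meas.
  - exact/measurable_EFinP.
  - by move=> x _; rewrite lee_fin.
have Z_y w : Z t w @[t --> +oo%R] --> I w.
  apply: nondecreasing_cvge_pinfty => //.
  apply: cvg_reparam_integral_monotone => //.
  by move=> x m n mn; apply: k_nd; rewrite ler_nat.
have ZbarE : Zbar = I by apply/funext => w; apply: cvg_lim => //; exact: Z_y.
have condII1 : levy_exponent nut kbar < +oo.
  have := condII 1%R ltr01; rewrite /levy_exponent.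
  by under eq_integral do rewrite mul1r.
have Z_seq w (u : R^nat) (g : R -> R) : I w < +oo ->
    (forall x, k (u n) x @[n --> \oo] --> g x) ->
    Z (u n) w @[n --> \oo] --> reparam_integral L alpha g w.
  move=> Iw ug; apply: (cvg_reparam_integral_dominated _ mkbar) => // n x.
  by rewrite k_ge0 k_le.
have Z_df w : I w < +oo -> df_path (fine (I w)) (Z ^~ w).
  move=> Iw; have Ifin : I w \is a fin_num by rewrite ge0_fin_numE// (le_trans _ (Z_le 0%R w)).
  split.
  - exact: Z_nd.
  - move=> t.
    have Zt : Z t w \is a fin_num by rewrite ge0_fin_numE// (le_lt_trans (Z_le t w)).
    rewrite -(fineK Zt); apply/cvge_at_rightP => u ut.
    rewrite fineK//; apply: Z_seq => // x.
    by have /cvg_at_rightP := k_rc x t; exact.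
  - apply/cvge_ninftyP => u uNy.
    rewrite (_ : 0 = reparam_integral L alpha (cst 0%R) w); last first.
      by rewrite /reparam_integral integral0_eq.
    by apply: Z_seq => // x; exact: (cvg_comp _ _ uNy (k_Ny x)).
  - by rewrite fineK.
split; split.
- exact: mZ.
- apply: filterS (ae_reparam_integral_lty nuL nutE mkbar kbar0 condII1) => w Iw.
  by exists (fine (I w)); exact: Z_df.
- move=> t; apply: emeasurable_funM => //; rewrite ZbarE.
  by apply: measurable_inve => // w; exact: reparam_integral_ge0.
- apply: filterS2 (ae_reparam_integral_lty nuL nutE mkbar kbar0 condII1)
    (ae_reparam_integral_gt0 nuL nutE mkbar kbar0 condIII_kbar) => w Iw I0.
  have [] := Z_df w Iw.
  have Ifin : I w \is a fin_num by rewrite ge0_fin_numE// ltW.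
  have r0 : (0 < fine (I w))%R by rewrite fine_gt0// I0.
  rewrite /F ZbarE -(fineK Ifin); set r := fine (I w) in r0 *.
  move=> _ Zrc ZNy Zy; rewrite inver gt_eqF//; split.
  - by move=> s t st; rewrite lee_wpmul2r ?Z_nd// lee_fin invr_ge0 ltW.
  - by move=> t; apply: cvgeZr => //; exact: Zrc.
  - by rewrite -(mul0e (r^-1)%:E); apply: cvgeZr.
  - rewrite [X in _ --> X](_ : _ = r%:E * (r^-1)%:E); first exact: cvgeZr.
    by rewrite -EFinM divff// gt_eqF.
Unshelve. all: by end_near. Qed.
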